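(* Let $q$ be a prime power, $n$ a positive integer, $\gamma\in\mathbb{F}_{q^n}^{*}$, and let $u_1,\dots,u_{n-1}\in\mathbb{F}_{q^n}$ be such that $u_1,\dots,u_{n-1},\gamma$ is a basis of $\mathbb{F}_{q^n}$ over $\mathbb{F}_q$. Let $H(x)\in\mathbb{F}_{q^n}[x]$ be a polynomial such that $\mathrm{Tr}(H(x))$ is not a constant map on $\mathbb{F}_{q^n}$. Then there are at least $$\big((q^{n-1})!\big)^q-(q^n-q)(q^n-q^2)\cdots(q^n-q^{n-1})$$ permutation polynomials over $\mathbb{F}_{q^n}$ of the form $$u_1f_1(x)+\dots+u_{n-1}f_{n-1}(x)+\gamma\mathrm{Tr}(H_1(x))+\gamma\mathrm{Tr}(H(x)),$$ with $f_1,\dots,f_{n-1}$ maps from $\mathbb{F}_{q^n}$ to $\mathbb{F}_q$ and $H_1(x)\in\mathbb{F}_{q^n}[x]$, such that $$G(x)=u_1f_1(x)+\dots+u_{n-1}f_{n-1}(x)+\gamma\mathrm{Tr}(H_1(x))$$ is neither a permutation nor a linearized polynomial.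
   Context: $\mathrm{Tr}(x)=x+x^q+\dots+x^{q^{n-1}}$ is the trace from $\mathbb{F}_{q^n}$ to $\mathbb{F}_q$. Polynomials over $\mathbb{F}_{q^n}$ are identified with the maps $\mathbb{F}_{q^n}\to\mathbb{F}_{q^n}$ they induce (i.e. taken modulo $x^{q^n}-x$), and are counted as such. A polynomial is a permutation (polynomial) over $\mathbb{F}_{q^n}$ if it induces a bijection of $\mathbb{F}_{q^n}$. A linearized polynomial (also called $q$-polynomial) is one of the form $\sum_{i=0}^{n-1}a_ix^{q^i}$ with $a_i\in\mathbb{F}_{q^n}$. For $n=1$ the sums over $u_if_i$ are empty and the product $(q^n-q)\cdots(q^n-q^{n-1})$ is the empty product $1$. *)

(* Defs.v *)
From HB Require Import structures.
From mathcomp Require Import all_boot all_order all_algebra all_field.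

Set Implicit Arguments.
Unset Strict Implicit.
Unset Printing Implicit Defensive.

Import GRing.Theory.
Local Open Scope ring_scope.

Section Definitions.

Variables (F : finFieldType) (L : fieldExtType F) (q n : nat).

(* In the theorem #|F| = q and \dim {:L} = n, so that F is the field with q
   elements and L the field with q ^ n elements.  The trace is kept as an
   element of L; its values lie in the subfield 1%VS, the image of F. *)
Definition Tr (x : L) : L := \sum_(i < n) x ^+ (q ^ i).

Definition is_linearized (g : L -> L) : Prop :=
  exists a : 'I_n -> L, forall x, g x = \sum_(i < n) a i * x ^+ (q ^ i).

Definition is_perm_poly (P : {poly L}) : Prop := bijective (fun x : L => P.[x]).

(* The family u_1, ..., u_(n-1) is indexed from 0. *)
Definition Gmap (u : n.-1.-tuple L) (gamma : L) (f : 'I_n.-1 -> L -> F)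
    (H1 : {poly L}) (x : L) : L :=
  \sum_(i < n.-1) f i x *: tnth u i + gamma * Tr H1.[x].

(* g is the map induced by a permutation polynomial of the shape
   G(x) + gamma * Tr(H(x)) with G neither a permutation nor linearized. *)
Definition admissible (u : n.-1.-tuple L) (gamma : L) (H : {poly L})
    (g : L -> L) : Prop :=
  exists (P : {poly L}) (f : 'I_n.-1 -> L -> F) (H1 : {poly L}),
    [/\ forall x, g x = P.[x],
        is_perm_poly P,
        forall x, P.[x] = Gmap u gamma f H1 x + gamma * Tr H.[x],
        ~ bijective (Gmap u gamma f H1)
      & ~ is_linearized (Gmap u gamma f H1)].

End Definitions.

(* Main.v *)
Require Import Defs.
From mathcomp Require Import all_boot all_order all_algebra all_fingroup all_field.

(* Let c be the gamma-coordinate in the basis u, gamma, and h = Tr(H(x)), so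
   that every map P is G + gamma h for a unique G of the required shape, with
   c(G) = c(P) - h.  If c(P) - h is not balanced (each value taken q^(n-1)
   times) then G is not a permutation, and if c(P(0)) <> h(0) then G(0) <> 0
   and G is not linearized.  For one permutation p with both properties of
   c(p), all permutations s o p with c o s = c work as well, and there are
   ((q^(n-1))!)^q of them, so the bound holds even without the subtracted
   product.  To find p, pick x, y with h(x) <> h(y) and a permutation with
   different c-values at x and y: exchanging these two values changes the number
   of times c(p) - h takes some value.  Translating p ensures c(p(0)) <> h(0). *)

Set Implicit Arguments.
Unset Strict Implicit.
Unset Printing Implicit Defensive.
Import Order.TTheory GRing.Theory Num.Theory.
Local Open Scope ring_scope.

(** Each fibre of [c] is numbered by ['I_m], and one permutation of ['I_m] is chosen independently
    for each of the [#|C|] fibres; distinct choices glue to distinct permutations of [T]. *)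
Lemma card_perm_stab (T C : finType) (c : T -> C) (m : nat) :
    (forall a, #|[set x | c x == a]| = m) ->
  (m`! ^ #|C| <= #|[set s : {perm T} | [forall x, c (s x) == c x]]|)%N.
Proof.
move=> hc.
have xin x : x \in [set y | c y == c x] by rewrite inE.
pose e a (i : 'I_m) : T := enum_val (cast_ord (esym (hc a)) i).
pose r x : 'I_m := cast_ord (hc (c x)) (enum_rank_in (xin x) x).
have rK x : e (c x) (r x) = x by rewrite /e /r cast_ordK enum_rankK_in.
have ce a i : c (e a i) = a.
  by have := enum_valP (cast_ord (esym (hc a)) i); rewrite inE => /eqP.
have e_inj a : injective (e a) by move=> i j /enum_val_inj /cast_ord_inj.
have re a i : r (e a i) = i by apply: (e_inj a); rewrite -{1}(ce a i) rK.
pose act (t : {ffun C -> 'S_m}) x := e (c x) (t (c x) (r x)).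
have act_inj t : injective (act t).
  move=> x y exy; have cxy : c x = c y by have /(congr1 c) := exy; rewrite !ce.
  by move: exy; rewrite -{2}(rK x) -{2}(rK y) /act cxy => /e_inj/perm_inj->.
have <- : #|[set perm (act_inj t) | t in [set: {ffun C -> 'S_m}]]| =
    (m`! ^ #|C|)%N.
  rewrite card_imset ?cardsT ?card_ffun ?card_Sn // => t t' /permP ett'.
  apply/ffunP=> a; apply/permP=> i; apply: (e_inj a).
  by have := ett' (e a i); rewrite !permE /act ce re.
apply/subset_leq_card/subsetP=> _ /imsetP[t _ ->].
by rewrite inE; apply/forallP=> x; rewrite permE ce.
Qed.

(** Every fibre is a translate of the kernel, so all fibres have the same size. *)
Lemma card_fiber (U V : finZmodType) (f : {additive U -> V}) :
    (forall v, exists u, f u = v) ->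
  forall v, (#|V| * #|[set x | f x == v]| = #|U|)%N.
Proof.
move=> f_surj.
have fib0 v : #|[set x | f x == v]| = #|[set x | f x == 0]|.
  have [u <-] := f_surj v.
  rewrite -(card_imset [set x | f x == 0] (addrI u)); apply: eq_card => x.
  rewrite inE; apply/eqP/imsetP => [fxu | [y]].
    by exists (x - u); rewrite ?inE ?raddfB ?fxu ?subrr // addrC subrK.
  by rewrite inE => /eqP fy0 ->; rewrite raddfD fy0 addr0.
move=> v; rewrite fib0 -(sum1_card U) (partition_big f predT) //=.
rewrite -sum_nat_const; apply: eq_bigr => a _; rewrite -(fib0 a) -sum1_card.
by apply: eq_bigl => x; rewrite inE.
Qed.

Lemma exists_unbalanced_perm (U V : finZmodType) (f : {additive U -> V})
    (h : U -> V) (m : nat) (x y : U) :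
    (forall v, exists u, f u = v) -> h x != h y ->
  exists2 p : {perm U}, exists v, #|[set z | f (p z) - h z == v]| != m
                      & f (p 0) != h 0.
Proof.
move=> f_surj hxy.
have [w fw] := f_surj (h x - h y).
have fw0 : f w != 0 by rewrite fw subr_eq0.
suff [p [v pv]]: exists p : {perm U}, exists v,
    #|[set z | f (p z) - h z == v]| != m.
  (* Following [p] by translation by [w] adds the nonzero constant [f w] to [f (p z) - h z]: the
     counts are only relabelled, while equality at 0 is destroyed. *)
  have [p0 | p0] := eqVneq (f (p 0)) (h 0); last by exists p => //; exists v.
  have pw_inj : injective (fun z => p z + w) by move=> ? ? /addIr/perm_inj.
  exists (perm pw_inj); last first.
    by rewrite permE raddfD p0 -subr_eq0 addrAC subrr add0r.
  exists (v + f w); congr (_ != _): pv; apply: eq_card => z.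
  by rewrite !inE permE raddfD addrAC (inj_eq (addIr _)).
have xNy : x != y by apply: contraNneq hxy => ->.
(* [p] fixes [x] and sends [y] to [x + w], so its [f]-values there differ by [f w]. With [p], the
   point [x] is counted at [v]; after the exchange neither [x] nor [y] is. The two counts differ, so
   one of them is not [m]. *)
pose p := tperm y (x + w).
have xw : x + w != x.
  by apply: contraNneq fw0; rewrite -{2}(addr0 x) => /addrI->; rewrite raddf0.
have px : p x = x by rewrite tpermD // eq_sym.
have py : p y = x + w by rewrite tpermL.
pose p' := (tperm x y * p)%g.
pose v := f x - h x.
have proper :
    [set z | f (p' z) - h z == v] \proper [set z | f (p z) - h z == v].
  apply/properP; split; last first.
    exists x; rewrite !inE ?px // permM tpermL py raddfD addrAC -/v.
    by rewrite -subr_eq0 addrAC subrr add0r.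
  apply/subsetP=> z; rewrite !inE permM.
  case: tpermP => [->|->|//].
    by rewrite py raddfD addrAC -/v -subr_eq0 addrAC subrr add0r (negPf fw0).
  by rewrite px (inj_eq (addrI _)) eqr_opp eq_sym (negPf hxy).
have [pm|] := eqVneq #|[set z | f (p z) - h z == v]| m; last by exists p, v.
by exists p', v; rewrite neq_ltn -pm proper_card.
Qed.

Lemma finField_interpolation (K : finFieldType) (g : K -> K) :
  exists P : {poly K}, forall x, P.[x] = g x.
Proof.
have K_gt1 := finNzRing_gt1 K.
(* By Fermat, [1 - ('X - a%:P) ^+ #|K|.-1] induces the indicator function of [a]. *)
exists (\sum_a g a *: (1 - ('X - a%:P) ^+ #|K|.-1)) => x.
rewrite horner_sum (bigD1 x) //= big1 ?addr0 => [|a ax]; rewrite !hornerE.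
  by rewrite subrr expr0n -(subn1 #|K|) subn_eq0 leqNgt K_gt1 subr0 mulr1.
have xa0 : x - a != 0 by rewrite subr_eq0 eq_sym.
have -> : (x - a) ^+ #|K|.-1 = 1.
  by apply: (mulfI xa0); rewrite -exprS prednK ?(ltnW K_gt1) // expf_card mulr1.
by rewrite subrr mulr0.
Qed.

Section Trace.

Variables (F : finFieldType) (L : fieldExtType F).
Let q := #|F|.
Let n := \dim {:L}.

Lemma card_finvect : #|finvect_type L| = (q ^ n)%N.
Proof.
rewrite -(card_vspace (fullv : {vspace finvect_type L})).
by apply/esym/eq_card=> x; rewrite memvf.
Qed.

Lemma expf_cardX (a : F) i : a ^+ (q ^ i) = a.
Proof. by elim: i => [|i IHi]; rewrite ?expr1 // expnS exprM expf_card. Qed.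

Lemma TrZ (a : F) (x : L) : Tr q n (a *: x) = a *: Tr q n x.
Proof.
by rewrite /Tr scaler_sumr; apply: eq_bigr => i _; rewrite exprZn expf_cardX.
Qed.

Lemma pchar_card_nat : ([pchar L]%R).-nat q.
Proof.
have [p p_pr pF] := finPcharP F.
have [k ->] : exists k, q = (p ^ k)%N.
  by exists (logn p #|pPrimeCharType pF|); rewrite -(card_pprimeChar pF).
by rewrite pnatX pnatE // pchar_lalg pF.
Qed.

(** Raising to the power [q] is additive and permutes the terms of the trace cyclically, since
    [x ^+ (q ^ n) = x]; the fixed points of this map form the image of [F]. *)
Lemma Tr_in_base (x : L) : exists a : F, Tr q n x = a%:A.
Proof.
have cardL (y : L) : y ^+ (q ^ n) = y.
  by rewrite -card_finvect; apply: (@expf_card (finvect_type L)).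
have FrobD : {morph (fun y : L => y ^+ q) : y z / y + z}.
  by move=> y z; rewrite exprDn_pchar ?pchar_card_nat.
have Frob0 : (0 : L) ^+ q = 0.
  by rewrite expr0n gtn_eqF // (ltnW (finNzRing_gt1 F)).
apply/vlineP; rewrite Fermat's_little_theorem dimv1 expn1 -/q /Tr.
rewrite (big_morph _ FrobD Frob0).
rewrite -{1}(big_mkord predT (fun i => (x ^+ (q ^ i)) ^+ q)).
rewrite -{1}(big_mkord predT (fun i => x ^+ (q ^ i))).
under eq_bigr => i _ do rewrite -exprM -expnSr.
rewrite -[X in X == _](addrK (x ^+ (q ^ 0))) [X in X - _]addrC.
rewrite -(big_nat_recl n 0%N (fun i => x ^+ (q ^ i))) // big_nat_recr //=.
by rewrite cardL expr1 addrK.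
Qed.

End Trace.

(* [finvect_type L] is L itself, equipped with its finite type structure. *)
Theorem theorem4p1 (F : finFieldType) (L : fieldExtType F) (q n : nat)
    (hq : #|F| = q) (hn : \dim {:L} = n)
    (gamma : L) (hgamma : gamma != 0)
    (u : n.-1.-tuple L) (hu : basis_of {:L} (rcons u gamma))
    (H : {poly L})
    (hH : ~ exists c : L, forall x : L, Tr q n H.[x] = c) :
  exists A : {set {ffun finvect_type L -> finvect_type L}},
    (forall g, g \in A -> admissible q u gamma H g) /\
    (((q ^ n.-1)`! ^ q)%:Z - \prod_(1 <= i < n) ((q ^ n)%:Z - (q ^ i)%:Z)
       <= #|A|%:Z).
Proof.
pose T : finFieldType := finvect_type L.
pose B := [tuple of rcons u gamma].
have cardT : #|T| = (q ^ n)%N.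
  by rewrite card_finvect hq hn.
have TrF (x : L) : exists a : F, Tr q n x == a%:A.
  by rewrite -hq -hn; have [a ->] := Tr_in_base x; exists a.
have TrqZ (a : F) (x : L) : Tr q n (a *: x) = a *: Tr q n x.
  by rewrite -hq -hn TrZ.
pose h (x : T) : F := xchoose (TrF H.[x]).
have hE (x : L) : Tr q n H.[x] = (h x)%:A by apply/eqP/(xchooseP (TrF H.[x])).
have [x [y hxy]] : exists x y, h x != h y.
  have [/existsP[x /existsP[y hxy]] | /existsPn h0] :=
    boolP [exists x, exists y, h x != h y]; first by exists x, y.
  case: hH; exists (h 0)%:A => x; rewrite hE.
  by have /existsPn/(_ 0) := h0 x; rewrite negbK => /eqP->.
(* Of the two distinct values [h x] and [h y], one is nonzero. Multiples of [x0] then realize every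
   trace in [F]. *)
have [x0 [t t0 Trx0]] : exists x0 : L, exists2 t : F, t != 0 & Tr q n x0 = t%:A.
  have [hx0 | hx0] := eqVneq (h x) 0; last by exists H.[x], (h x).
  by exists H.[y], (h y) => //; rewrite -hx0 eq_sym.
have Bfree : free B by apply: basis_free hu.
pose c : {additive T -> F} := coord B ord_max.
have coordB (z : L) :
    z = \sum_(i < n.-1) coord B (widen_ord (leqnSn _) i) z *: tnth u i
        + c z *: gamma.
  rewrite {1}(coord_basis hu (memvf z)) big_ord_recr /=; congr (_ + _ *: _).
    apply: eq_bigr => i _; congr (_ *: _).
    by rewrite nth_rcons size_tuple ltn_ord (tnth_nth 0).
  by rewrite nth_rcons size_tuple ltnn eqxx.
have cZ (a : F) : c (a *: gamma) = a.
  rewrite /c /= linearZ /=; have -> : gamma = B`_(@ord_max n.-1).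
    by rewrite nth_rcons size_tuple ltnn eqxx.
  by rewrite coord_free // eqxx mulr1.
have c_surj v : exists z, c z = v by exists (v *: gamma); rewrite cZ.
have n_gt0 : (0 < n)%N by rewrite -hn adim_gt0.
have q_gt0 : (0 < q)%N by rewrite -hq (ltnW (finNzRing_gt1 F)).
have card_c v : #|[set z | c z == v]| = (q ^ n.-1)%N.
  have := card_fiber c_surj v; rewrite cardT hq -{1}(prednK n_gt0) expnS.
  by move/eqP; rewrite eqn_pmul2l // => /eqP.
have [p [v pv] p0] := exists_unbalanced_perm (q ^ n.-1) c_surj hxy.
pose S := [set s : {perm T} | [forall z, c (s z) == c z]].
pose app (s : {perm T}) : {ffun T -> T} := [ffun z => s (p z)].
have app_inj : injective app.
  move=> s s' /ffunP ess; apply/permP=> z.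
  by have := ess (p^-1 z)%g; rewrite !ffunE permKV.
exists (app @: S); split; last first.
  (* The set [S] alone reaches the factorial power, and the subtracted product has nonnegative
     factors. *)
  rewrite card_imset // lerBlDr.
  apply: (@le_trans _ _ #|S|%:Z).
    by rewrite lez_nat -hq card_perm_stab // hq.
  rewrite lerDl big_nat prodr_ge0 // => i /andP[_ ltin].
  by rewrite subr_ge0 lez_nat leq_pexp2l ?(ltnW ltin).
move=> g /imsetP[s]; rewrite inE => /forallP cs ->.
have [P PE] : exists P : {poly L}, forall z, P.[z] = app s z :=
  @finField_interpolation T (app s).
(* The scaling by [t] gives [g1 z] the trace [c (p z) - h z], the [gamma]-coordinate required of
   G. *)
pose g1 (z : L) : L := ((c (p z) - h z) / t) *: x0.
have [H1 H1E] : exists H1 : {poly L}, forall z, H1.[z] = g1 z :=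
  @finField_interpolation T g1.
pose f (i : 'I_n.-1) (z : L) : F := coord B (widen_ord (leqnSn _) i) (app s z).
have TrH1 (z : L) : Tr q n H1.[z] = (c (p z) - h z)%:A.
  by rewrite H1E TrqZ Trx0 scalerA divfK.
have capp z : c (app s z) = c (p z) by rewrite ffunE (eqP (cs _)).
have GE (z : L) : app s z = Gmap q u gamma f H1 z + gamma * Tr q n H.[z].
  rewrite /Gmap TrH1 hE -addrA -mulrDr -scalerDl subrK [LHS]coordB capp.
  by rewrite -scalerAr mulr1.
have cG (z : T) : c (Gmap q u gamma f H1 z) = c (p z) - h z.
  have -> : Gmap q u gamma f H1 z = (app s z : T) - h z *: gamma.
    by rewrite GE hE -scalerAr mulr1 addrK.
  by rewrite raddfB cZ capp.
exists P, f, H1; split.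
- by move=> z; rewrite PE.
- apply: (@injF_bij T) => z1 z2.
  by rewrite !PE !ffunE => /perm_inj/perm_inj.
- by move=> z; rewrite PE GE.
(* If G were bijective, [c] composed with G would take [v] as often as [c] does. *)
- move=> Gbij; case/eqP: pv; rewrite -(card_c v).
  rewrite -[RHS](on_card_preimset (onW_bij _ (Gbij : @bijective T T _))).
  by apply: eq_card => z; rewrite !inE cG.
(* A linearized map vanishes at 0, as every exponent [q ^ i] is positive. *)
- case=> a Ga; case/negP: p0; rewrite -subr_eq0 -cG Ga big1 ?raddf0 // => i _.
  by rewrite expr0n expn_eq0 gtn_eqF ?mulr0.
Qed.
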